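(* Let $\mathcal{C}$ be a homological category, let $(\mathbf{R},\mu)$ be a radical on $\mathcal{C}$, and let $\mathcal{X}$ be the full subcategory of $\mathcal{C}$ of objects $X$ with $\mathbf{R}(X)=0$. Then a morphism of $\mathcal{X}$ is a regular epimorphism in $\mathcal{X}$ if and only if it is a regular epimorphism in $\mathcal{C}$. Moreover, the category $\mathcal{X}$ is homological.
   Context: A category is homological if it is pointed, regular and protomodular. A normal monomorphism is a monomorphism that is a kernel; in a homological category every normal monomorphism $C\rightarrowtail C'$ has a cokernel, whose codomain is denoted $C'/C$. A radical on a homological category $\mathcal{C}$ is a pair $(\mathbf{R},\mu)$, where $\mathbf{R}$ is an endofunctor of $\mathcal{C}$ and $\mu:\mathbf{R}\to 1_{\mathcal{C}}$ is a natural transformation such that, for every object $C$, $\mu_C:\mathbf{R}(C)\to C$ is a normal monomorphism and $\mathbf{R}(C/\mathbf{R}(C))=0$. The subcategory $\mathcal{X}$ is reflective in $\mathcal{C}$, with reflector $C\mapsto C/\mathbf{R}(C)$ and unit $\eta_C:C\to C/\mathbf{R}(C)$ the cokernel of $\mu_C$. *)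

(* Defs.v *)
From Stdlib Require Import FinFun ProofIrrelevance.

Set Implicit Arguments.
Unset Strict Implicit.
Unset Printing Implicit Defensive.

Record Category : Type := {
  Ob :> Type;
  Hom : Ob -> Ob -> Type;
  idm : forall A : Ob, Hom A A;
  comp : forall A B D : Ob, Hom B D -> Hom A B -> Hom A D;
  comp_id_l : forall (A B : Ob) (f : Hom A B), comp (idm B) f = f;
  comp_id_r : forall (A B : Ob) (f : Hom A B), comp f (idm A) = f;
  comp_assoc : forall (A B D E : Ob) (h : Hom D E) (g : Hom B D) (f : Hom A B),
    comp h (comp g f) = comp (comp h g) f
}.

Arguments Hom {c} _ _.
Arguments idm {c} _.
Arguments comp {c A B D} _ _.

Notation "g ∘ f" := (comp g f) (at level 40, left associativity).

Record Functor (C D : Category) : Type := {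
  fobj :> C -> D;
  fmap : forall X Y : C, Hom X Y -> Hom (fobj X) (fobj Y);
  fmap_id : forall X : C, fmap (idm X) = idm (fobj X);
  fmap_comp : forall (X Y Z : C) (g : Hom Y Z) (f : Hom X Y),
    fmap (g ∘ f) = fmap g ∘ fmap f
}.

Arguments fmap {C D} _ {X Y} _.

Definition id_functor (C : Category) : Functor C C :=
  {| fobj := fun X : C => X;
     fmap := fun (X Y : C) (f : Hom X Y) => f;
     fmap_id := fun X => eq_refl;
     fmap_comp := fun X Y Z g f => eq_refl |}.

Record NatTrans (C D : Category) (F G : Functor C D) : Type := {
  component :> forall X : C, Hom (F X) (G X);
  naturality : forall (X Y : C) (f : Hom X Y),
    component Y ∘ fmap F f = fmap G f ∘ component X
}.

Definition full_subcategory (C : Category) (P : C -> Prop) : Category :=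
  {| Ob := {X : C | P X};
     Hom := fun X Y => Hom (proj1_sig X) (proj1_sig Y);
     idm := fun X => idm (proj1_sig X);
     comp := fun X Y Z g f => g ∘ f;
     comp_id_l := fun X Y f => comp_id_l f;
     comp_id_r := fun X Y f => comp_id_r f;
     comp_assoc := fun X Y Z W h g f => comp_assoc h g f |}.

Definition inclusion (C : Category) (P : C -> Prop) :
    Functor (full_subcategory P) C :=
  {| fobj := fun X : full_subcategory P => proj1_sig X;
     fmap := fun (X Y : full_subcategory P) (f : Hom X Y) => f;
     fmap_id := fun X => eq_refl;
     fmap_comp := fun X Y Z g f => eq_refl |}.

Definition is_iso (C : Category) (A B : C) (f : Hom A B) : Prop :=
  exists g : Hom B A, g ∘ f = idm A /\ f ∘ g = idm B.

Definition is_mono (C : Category) (A B : C) (m : Hom A B) : Prop :=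
  forall (T : C) (x y : Hom T A), m ∘ x = m ∘ y -> x = y.

Definition is_coequalizer (C : Category) (A B Q : C)
    (f g : Hom A B) (q : Hom B Q) : Prop :=
  q ∘ f = q ∘ g /\
  forall (T : C) (h : Hom B T), h ∘ f = h ∘ g ->
    exists! u : Hom Q T, u ∘ q = h.

Definition is_regular_epi (C : Category) (B Q : C) (q : Hom B Q) : Prop :=
  exists (A : C) (f g : Hom A B), is_coequalizer f g q.

(* The square with [f ∘ p = g ∘ q] is a pullback of [f] and [g]. *)
Definition is_pullback (C : Category) (A B D P : C)
    (f : Hom A D) (g : Hom B D) (p : Hom P A) (q : Hom P B) : Prop :=
  f ∘ p = g ∘ q /\
  forall (T : C) (h : Hom T A) (k : Hom T B), f ∘ h = g ∘ k ->
    exists! u : Hom T P, p ∘ u = h /\ q ∘ u = k.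

Definition is_kernel_pair (C : Category) (A B K : C)
    (f : Hom A B) (p q : Hom K A) : Prop :=
  is_pullback f f p q.

Definition is_cone (J C : Category) (D : Functor J C) (L : C)
    (p : forall j : J, Hom L (D j)) : Prop :=
  forall (i j : J) (u : Hom i j), fmap D u ∘ p i = p j.

Definition is_limit (J C : Category) (D : Functor J C) (L : C)
    (p : forall j : J, Hom L (D j)) : Prop :=
  is_cone p /\
  forall (M : C) (q : forall j : J, Hom M (D j)), is_cone q ->
    exists! h : Hom M L, forall j : J, p j ∘ h = q j.

Definition is_finite_category (J : Category) : Prop :=
  Finite J /\ forall i j : J, Finite (Hom i j).

Definition finitely_complete (C : Category) : Prop :=
  forall (J : Category) (D : Functor J C), is_finite_category J ->
    exists (L : C) (p : forall j : J, Hom L (D j)), is_limit p.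

Definition regular (C : Category) : Prop :=
  finitely_complete C /\
  (forall (A B K : C) (f : Hom A B) (p q : Hom K A), is_kernel_pair f p q ->
    exists (Q : C) (e : Hom A Q), is_coequalizer p q e) /\
  (forall (A B D P : C) (f : Hom A D) (g : Hom B D) (p : Hom P A) (q : Hom P B),
    is_pullback f g p q -> is_regular_epi f -> is_regular_epi q).

Definition is_initial (C : Category) (Z : C) : Prop :=
  forall X : C, exists! f : Hom Z X, True.

Definition is_terminal (C : Category) (Z : C) : Prop :=
  forall X : C, exists! f : Hom X Z, True.

Definition is_zero (C : Category) (Z : C) : Prop :=
  is_initial Z /\ is_terminal Z.

Definition pointed (C : Category) : Prop := exists Z : C, is_zero Z.

Definition is_zero_morphism (C : Category) (A B : C) (f : Hom A B) : Prop :=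
  exists (Z : C) (a : Hom A Z) (b : Hom Z B), is_zero Z /\ f = b ∘ a.

Definition is_kernel (C : Category) (A B K : C)
    (f : Hom A B) (k : Hom K A) : Prop :=
  is_zero_morphism (f ∘ k) /\
  forall (T : C) (h : Hom T A), is_zero_morphism (f ∘ h) ->
    exists! u : Hom T K, k ∘ u = h.

Definition is_cokernel (C : Category) (A B Q : C)
    (f : Hom A B) (q : Hom B Q) : Prop :=
  is_zero_morphism (q ∘ f) /\
  forall (T : C) (h : Hom B T), is_zero_morphism (h ∘ f) ->
    exists! u : Hom Q T, u ∘ q = h.

Definition is_normal_mono (C : Category) (K A : C) (k : Hom K A) : Prop :=
  is_mono k /\ exists (B : C) (f : Hom A B), is_kernel f k.

(* The category [Pt B] of points over [B], i.e. split epimorphisms with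
   codomain [B] and a chosen section. *)
Record Point (C : Category) (B : C) : Type := {
  pt_ob : C;
  pt_proj : Hom pt_ob B;
  pt_sec : Hom B pt_ob;
  pt_split : pt_proj ∘ pt_sec = idm B
}.

Record PointHom (C : Category) (B : C) (P Q : Point B) : Type := {
  pt_hom : Hom (pt_ob P) (pt_ob Q);
  pt_hom_proj : pt_proj Q ∘ pt_hom = pt_proj P;
  pt_hom_sec : pt_hom ∘ pt_sec P = pt_sec Q
}.

Lemma PointHom_eq (C : Category) (B : C) (P Q : Point B) (f g : PointHom P Q) :
  pt_hom f = pt_hom g -> f = g.
Proof.
destruct f as [f f1 f2], g as [g g1 g2]; simpl; intros e.
destruct e.
now rewrite (proof_irrelevance _ f1 g1), (proof_irrelevance _ f2 g2).
Qed.

Definition PointHom_id (C : Category) (B : C) (P : Point B) : PointHom P P.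
Proof.
exists (idm (pt_ob P)); [apply comp_id_r | apply comp_id_l].
Defined.

Definition PointHom_comp (C : Category) (B : C) (P Q S : Point B)
  (g : PointHom Q S) (f : PointHom P Q) : PointHom P S.
Proof.
exists (pt_hom g ∘ pt_hom f).
- now rewrite comp_assoc, pt_hom_proj, pt_hom_proj.
- now rewrite <- comp_assoc, pt_hom_sec, pt_hom_sec.
Defined.

Definition Pt (C : Category) (B : C) : Category.
Proof.
refine {| Ob := Point B; Hom := @PointHom C B;
          idm := @PointHom_id C B; comp := @PointHom_comp C B |};
  intros; apply PointHom_eq; simpl.
- apply comp_id_l.
- apply comp_id_r.
- apply comp_assoc.
Defined.

(* [t] exhibits [P'] as a value at [P] of the change-of-base functor
   [v^* : Pt B -> Pt B'], given by pulling back the split epimorphism along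
   [v]; the section of [P'] is the one induced by the section of [P]. *)
Definition is_base_change (C : Category) (B' B : C) (v : Hom B' B)
    (P' : Pt B') (P : Pt B) (t : Hom (pt_ob P') (pt_ob P)) : Prop :=
  is_pullback (pt_proj P) v t (pt_proj P') /\
  t ∘ pt_sec P' = pt_sec P ∘ v.

(* Every change-of-base functor [v^*] exists and reflects isomorphisms. It is
   determined only up to a choice of pullbacks, so its values [P'], [Q'] and
   [f' = v^* f] range over all such choices; [f'] is the morphism induced
   between the pullbacks by the equation [tQ ∘ f' = f ∘ tP]. *)
Definition protomodular (C : Category) : Prop :=
  (forall (B' B : C) (v : Hom B' B) (P : Pt B),
    exists (P' : Pt B') (t : Hom (pt_ob P') (pt_ob P)), is_base_change v t) /\
  (forall (B' B : C) (v : Hom B' B) (P Q : Pt B) (P' Q' : Pt B')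
      (tP : Hom (pt_ob P') (pt_ob P)) (tQ : Hom (pt_ob Q') (pt_ob Q))
      (f : Hom P Q) (f' : Hom P' Q'),
    is_base_change v tP -> is_base_change v tQ ->
    tQ ∘ pt_hom f' = pt_hom f ∘ tP ->
    is_iso f' -> is_iso f).

Definition homological (C : Category) : Prop :=
  pointed C /\ regular C /\ protomodular C.

(* [rad_quotient]: the quotient [X / R X] is the codomain of any cokernel of
   [mu X]. Cokernels are unique up to isomorphism, and exist when [C] is
   homological because [mu X] is a normal monomorphism. *)
Record Radical (C : Category) : Type := {
  rad :> Functor C C;
  rad_mu : NatTrans rad (id_functor C);
  rad_normal : forall X : C, is_normal_mono (rad_mu X);
  rad_quotient : forall (X Q : C) (q : Hom X Q),
    is_cokernel (rad_mu X) q -> is_zero (rad Q)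
}.

Definition radical_free (C : Category) (R : Radical C) (X : C) : Prop :=
  is_zero (R X).

(* Main.v *)
(** If a family of maps [p i : L -> D i] into radical-free objects is jointly
    monic, then [L] is radical-free: by naturality [p i ∘ mu L] factors through
    [R (D i) = 0], so any two maps into [R L] agree after the monomorphism
    [mu L]. Closure under jointly monic families contains closure under limits
    and under subobjects, and this alone makes a full subcategory inherit the
    homological structure: finite limits are computed in [C], and the regular
    image in [C] of a map of the subcategory is a subobject of its codomain,
    hence stays in the subcategory. *)

From Stdlib Require Import FinFun List.
Require Import Defs.
Import ListNotations.

Set Implicit Arguments.
Unset Strict Implicit.
Unset Printing Implicit Defensive.

Definition jointly_monic (C : Category) (I : Type) (L : C) (D : I -> C)
    (p : forall i : I, Hom L (D i)) : Prop :=
  forall (T : C) (x y : Hom T L), (forall i : I, p i ∘ x = p i ∘ y) -> x = y.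

Definition closed_under_jointly_monic (C : Category) (P : C -> Prop) : Prop :=
  forall (I : Type) (L : C) (D : I -> C) (p : forall i : I, Hom L (D i)),
    jointly_monic p -> (forall i : I, P (D i)) -> P L.

(** * Pullbacks as limits over the cospan category *)

Inductive cospan_ob : Type := cospan_left | cospan_right | cospan_tip.

(** Computing the hom-types by [match] makes every arrow [tt] or a contradiction after case
    analysis, which settles the category laws. *)
Definition cospan_hom (i j : cospan_ob) : Type :=
  match i, j with
  | cospan_left, cospan_left | cospan_right, cospan_right
  | _, cospan_tip => unit
  | _, _ => Empty_set
  end.

Definition cospan : Category.
Proof.
unshelve refine {| Ob := cospan_ob; Hom := cospan_hom |}.
- intros []; exact tt.
- intros [] [] []; simpl; intros g f; try exact tt; contradiction.
- intros [] [] []; reflexivity.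
- intros [] [] []; reflexivity.
- intros [] [] [] [] [] [] []; reflexivity.
Defined.

Lemma cospan_finite : is_finite_category cospan.
Proof.
split.
- exists [cospan_left; cospan_right; cospan_tip]; intros []; simpl; auto.
- assert (hu : Finite unit) by (exists [tt]; intros []; simpl; auto).
  assert (he : Finite Empty_set) by (exists []; intros []).
  intros [] []; assumption.
Qed.

Section Pullbacks.

Variable C : Category.

Definition cospan_functor (A B D : C) (f : Hom A D) (g : Hom B D) :
  Functor cospan C.
Proof.
unshelve refine {| fobj := fun i : cospan =>
  match i with cospan_left => A | cospan_right => B | cospan_tip => D end |}.
- intros [] [] u; try contradiction u;
    [exact (idm A) | exact f | exact (idm B) | exact g | exact (idm D)].
- intros []; reflexivity.
- intros [] [] [] [] []; simpl; now rewrite ?comp_id_l, ?comp_id_r.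
Defined.

Lemma pullback_exists (hC : finitely_complete C) (A B D : C)
    (f : Hom A D) (g : Hom B D) :
  exists (P : C) (p : Hom P A) (q : Hom P B), is_pullback f g p q.
Proof.
destruct (hC _ (cospan_functor f g) cospan_finite) as [L [p [hp hu]]].
exists L, (p cospan_left), (p cospan_right); split.
- transitivity (p cospan_tip).
  + exact (hp cospan_left cospan_tip tt).
  + symmetry; exact (hp cospan_right cospan_tip tt).
- intros T h k e.
  destruct (hu T (fun i : cospan => match i with
     | cospan_left => h | cospan_right => k | cospan_tip => f ∘ h end))
    as [u [hpu hun]].
  + intros [] [] []; simpl; now rewrite ?comp_id_l.
  + exists u; split.
    * exact (conj (hpu cospan_left) (hpu cospan_right)).
    * intros v [h1 h2]; apply hun.
      intros [].
      -- exact h1.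
      -- exact h2.
      (* The leg at the tip is determined by the left leg. *)
      -- rewrite <- (hp cospan_left cospan_tip tt : f ∘ p cospan_left = _).
         now rewrite <- comp_assoc, h1.
Qed.

Lemma pullback_unique (A B D P : C) (f : Hom A D) (g : Hom B D)
    (p : Hom P A) (q : Hom P B) (hp : is_pullback f g p q)
    (T : C) (x y : Hom T P) :
  p ∘ x = p ∘ y -> q ∘ x = q ∘ y -> x = y.
Proof.
destruct hp as [e hu]; intros h1 h2.
destruct (hu T (p ∘ x) (q ∘ x)) as [u [_ hun]].
{ now rewrite !comp_assoc, e. }
rewrite <- (hun x (conj eq_refl eq_refl)).
now apply hun; split.
Qed.

Lemma base_change_exists (hC : finitely_complete C) (B' B : C)
    (v : Hom B' B) (P : Pt B) :
  exists (P' : Pt B') (t : Hom (pt_ob P') (pt_ob P)), is_base_change v t.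
Proof.
destruct (pullback_exists hC (pt_proj P) v) as [K [p [q hp]]].
destruct (proj2 hp B' (pt_sec P ∘ v) (idm B')) as [s [[hs1 hs2] _]].
{ now rewrite comp_assoc, pt_split, comp_id_l, comp_id_r. }
exists (Build_Point hs2 : Pt B'), p.
exact (conj hp hs1).
Qed.

(** * Regular epimorphisms and image factorizations *)

Lemma regular_epi_cancel (A B : C) (e : Hom A B) :
  is_regular_epi e ->
  forall (T : C) (x y : Hom B T), x ∘ e = y ∘ e -> x = y.
Proof.
intros [K [a [b [hab hu]]]] T x y h.
destruct (hu T (x ∘ e)) as [u [_ hun]].
{ now rewrite <- !comp_assoc, hab. }
now rewrite <- (hun x eq_refl), (hun y (eq_sym h)).
Qed.

(** Any pair that [e] coequalizes factors through the kernel pair, so a map that equalizes [p] and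
    [q] also equalizes that pair. *)
Lemma regular_epi_coequalizes_kernel_pair (A B K : C) (e : Hom A B)
    (p q : Hom K A) :
  is_regular_epi e -> is_kernel_pair e p q -> is_coequalizer p q e.
Proof.
intros [L [a [b [hab hu]]]] [hpq hk]; split; [exact hpq |].
intros T h hh; apply hu.
destruct (hk L a b hab) as [w [[<- <-] _]].
now rewrite !comp_assoc, hh.
Qed.

(** Suppose [m ∘ x = m ∘ y]. Pulling back [e] lifts [x], then [y], to [A] over regular epimorphic
    covers [t1] and [t2]. The two lifts agree after [f], hence factor through its kernel pair and
    agree after [e]. Cancelling the covers gives [x = y]. *)
Lemma image_mono (hC : regular C) (A B Q K : C) (f : Hom A B)
    (p q : Hom K A) (e : Hom A Q) (m : Hom Q B) :
  is_kernel_pair f p q -> is_coequalizer p q e -> m ∘ e = f -> is_mono m.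
Proof.
destruct hC as [hlim [_ hstab]]; intros hk he hm T x y hxy.
assert (hreg : is_regular_epi e) by (exists K, p, q; exact he).
destruct (pullback_exists hlim e x) as [T1 [x1 [t1 h1]]].
pose proof (regular_epi_cancel (hstab _ _ _ _ _ _ _ _ h1 hreg)) as ht1.
destruct (pullback_exists hlim e (y ∘ t1)) as [T2 [y1 [t2 h2]]].
pose proof (regular_epi_cancel (hstab _ _ _ _ _ _ _ _ h2 hreg)) as ht2.
apply ht1, ht2.
destruct h1 as [h1 _], h2 as [h2 _].
destruct (proj2 hk T2 (x1 ∘ t2) y1) as [u [[hu1 hu2] _]].
{ rewrite <- hm, <- (comp_assoc m e y1), h2, !comp_assoc, <- hxy.
  now rewrite <- (comp_assoc m e x1), h1, !comp_assoc. }
rewrite <- h1, <- h2, <- comp_assoc, <- hu1, <- hu2, !comp_assoc.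
now rewrite (proj1 he).
Qed.

Lemma image_factorization (hC : regular C) (A B : C) (f : Hom A B) :
  exists (Q : C) (e : Hom A Q) (m : Hom Q B),
    is_regular_epi e /\ is_mono m /\ m ∘ e = f.
Proof.
destruct (pullback_exists (proj1 hC) f f) as [K [p [q hk]]].
destruct (proj1 (proj2 hC) _ _ _ _ _ _ hk) as [Q [e he]].
destruct (proj2 he B f (proj1 hk)) as [m [hm _]].
exists Q, e, m; split; [exists K, p, q; exact he |].
split; [exact (image_mono hC hk he hm) | exact hm].
Qed.

Lemma regular_epi_comp_iso (A Q B : C) (e : Hom A Q) (m : Hom Q B) :
  is_regular_epi e -> is_iso m -> is_regular_epi (m ∘ e).
Proof.
intros [K [a [b [hab hu]]]] [n [hnm hmn]]; exists K, a, b; split.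
- now rewrite <- !comp_assoc, hab.
- intros T h hh.
  destruct (hu T h hh) as [u [hue hun]].
  exists (u ∘ n); split.
  + now rewrite comp_assoc, <- (comp_assoc u n m), hnm, comp_id_r.
  + intros w hw.
    rewrite (hun (w ∘ m)).
    * now rewrite <- comp_assoc, hmn, comp_id_r.
    * now rewrite <- comp_assoc.
Qed.

(** The composite of [A] to the zero object and back equals [idm A], so maps out of [A] inherit
    uniqueness from the zero object. *)
Lemma zero_of_unique_maps (hC : pointed C) (A : C) :
  (forall (T : C) (x y : Hom T A), x = y) -> is_zero A.
Proof.
intros hA; destruct hC as [Z [hi ht]].
destruct (hi A) as [i [_ _]], (ht A) as [j [_ _]].
split; intros X.
- destruct (hi X) as [g [_ hg]].
  exists (g ∘ j); split; [exact I |]; intros h _.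
  rewrite (hg (h ∘ i) I), <- comp_assoc, (hA _ (i ∘ j) (idm A)).
  apply comp_id_r.
- destruct (ht X) as [g _].
  exists (i ∘ g); split; [exact I |]; intros; apply hA.
Qed.

End Pullbacks.

Definition comp_functor (A B C : Category) (G : Functor B C)
    (F : Functor A B) : Functor A C.
Proof.
unshelve refine {| fobj := fun X : A => G (F X);
                   fmap := fun (X Y : A) (f : Hom X Y) => fmap G (fmap F f) |}.
- intros; now rewrite !fmap_id.
- intros; now rewrite !fmap_comp.
Defined.

(** * Full subcategories closed under jointly monic families *)

Section FullSubcategory.

Variables (C : Category) (P : C -> Prop).
Hypothesis P_closed : closed_under_jointly_monic P.

Local Notation X := (full_subcategory P).
(* The eta-expanded predicate is the one in [Ob (full_subcategory P)];
   [rewrite] does not identify it with [P]. *)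
Local Notation "⌊ A ⌋" := (proj1_sig (P := fun Z : C => P Z) A)
  (at level 0, A at level 99).

Lemma closed_subobject (S A : C) (m : Hom S A) : is_mono m -> P A -> P S.
Proof.
intros hm hA.
apply (P_closed (I := unit) (D := fun _ => A) (p := fun _ => m)).
- intros T x y h; exact (hm T x y (h tt)).
- intros _; exact hA.
Qed.

Lemma closed_pullback (A B D K : C) (f : Hom A D) (g : Hom B D)
    (p : Hom K A) (q : Hom K B) :
  is_pullback f g p q -> P A -> P B -> P K.
Proof.
intros hp hA hB.
apply (P_closed (I := bool) (D := fun b : bool => if b then A else B)
  (p := fun b : bool => if b return Hom K (if b then A else B) then p else q)).
- intros T x y h; exact (pullback_unique hp (h true) (h false)).
- intros []; assumption.
Qed.

Lemma full_subcategory_finitely_complete :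
  finitely_complete C -> finitely_complete X.
Proof.
intros hC J D hJ.
destruct (hC J (comp_functor (inclusion P) D) hJ) as [L [p [hp hu]]].
assert (hL : P L).
{ apply (P_closed (p := p)).
  - intros T x y h.
    destruct (hu T (fun j => p j ∘ x)) as [w [_ hw]].
    { intros i j a; now rewrite comp_assoc, hp. }
    rewrite <- (hw x (fun j => eq_refl)).
    apply hw; intros j; now rewrite h.
  - intros j; exact (proj2_sig (D j)). }
exists (exist P L hL : X), p; split; [exact hp |].
intros M; exact (hu ⌊M⌋).
Qed.

(** For the direct implication, test objects may lie outside the subcategory. The pullback [K0]
    taken in [C] lies inside by closure, so it can be compared with [K]: the comparison maps satisfy
    [w ∘ v = idm K], and [w] carries factorizations through [K0] to factorizations through [K]. *)
Lemma pullback_full_subcategory (hC : finitely_complete C) (A B D K : X)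
    (f : Hom A D) (g : Hom B D) (p : Hom K A) (q : Hom K B) :
  is_pullback f g p q <->
  is_pullback (C := C) (A := ⌊A⌋) (B := ⌊B⌋) (D := ⌊D⌋) (P := ⌊K⌋) f g p q.
Proof.
split; intros [e hu]; (split; [exact e |]);
  [intros T h k hk | intros T; exact (hu ⌊T⌋)].
destruct (pullback_exists hC (A := ⌊A⌋) (B := ⌊B⌋) (D := ⌊D⌋) f g)
  as [K0 [p0 [q0 h0]]].
pose (K1 := exist P K0
  (closed_pullback h0 (proj2_sig A) (proj2_sig B)) : X).
destruct (hu K1 p0 q0 (proj1 h0)) as [w [[hw1 hw2] _]].
destruct (proj2 h0 ⌊K⌋ p q e) as [v [[hv1 hv2] _]].
simpl in w, hw1, hw2.
assert (hwv : w ∘ v = idm ⌊K⌋).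
{ destruct (hu K p q e) as [i [_ hi]].
  simpl in p, q, i, hi.
  transitivity i; [symmetry |]; apply hi; split.
  - now rewrite comp_assoc, hw1.
  - now rewrite comp_assoc, hw2.
  - apply comp_id_r.
  - apply comp_id_r. }
destruct (proj2 h0 T h k hk) as [t [[ht1 ht2] _]].
exists (w ∘ t); split.
- now rewrite !comp_assoc, hw1, hw2.
- intros u [hu1 hu2].
  rewrite <- (comp_id_l u), <- hwv, <- comp_assoc; f_equal.
  apply (pullback_unique h0); rewrite comp_assoc; congruence.
Qed.

(** Given a coequalizer [f] in the subcategory, factor it in [C] as [m ∘ e]. The image is a
    subobject of [B], so [e] is a competing map in the subcategory and factors through [f]. This
    splits the monomorphism [m], which is therefore invertible. Conversely, the kernel pair in [C]
    lies in the subcategory, and [f] is its coequalizer there by fullness. *)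
Lemma regular_epi_full_subcategory (hC : regular C) (A B : X) (f : Hom A B) :
  is_regular_epi f <-> is_regular_epi (fmap (inclusion P) f).
Proof.
split; intros hf; simpl in *.
- pose proof (regular_epi_cancel hf) as hepi.
  destruct hf as [K [a [b [hab hu]]]].
  destruct (image_factorization hC (A := ⌊A⌋) (B := ⌊B⌋) f)
    as [Q [e [m [he [hm hme]]]]].
  pose (Q1 := exist P Q (closed_subobject hm (proj2_sig B)) : X).
  destruct (hu Q1 e) as [n [hn _]]; simpl in *.
  { apply hm; rewrite !comp_assoc, hme; exact hab. }
  assert (hmn : m ∘ n = idm ⌊B⌋).
  { apply (hepi B (m ∘ n) (idm ⌊B⌋)); simpl.
    now rewrite <- comp_assoc, hn, comp_id_l. }
  rewrite <- hme.
  apply regular_epi_comp_iso; [exact he |].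
  exists n; split; [| exact hmn].
  apply hm; now rewrite comp_assoc, hmn, comp_id_l, comp_id_r.
- destruct (pullback_exists (proj1 hC) (A := ⌊A⌋) (B := ⌊A⌋) (D := ⌊B⌋) f f)
    as [K [p [q hk]]].
  pose (K1 := exist P K (closed_pullback hk (proj2_sig A) (proj2_sig A)) : X).
  destruct (regular_epi_coequalizes_kernel_pair hf hk) as [e hu].
  exists K1, p, q; split; [exact e |].
  intros T; exact (hu ⌊T⌋).
Qed.

Lemma full_subcategory_regular : regular C -> regular X.
Proof.
intros hC; pose proof hC as [hlim [hcoeq hstab]].
split; [exact (full_subcategory_finitely_complete hlim) | split].
- intros A B K f p q hk.
  pose proof (proj1 (pullback_full_subcategory hlim f f p q) hk) as hk'.
  destruct (hcoeq _ _ _ _ _ _ hk') as [Q [e he]].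
  (* The coequalizer of the kernel pair of [f] is the image of [f], a subobject of [B], so it stays
     in the subcategory. *)
  destruct (proj2 he ⌊B⌋ f (proj1 hk)) as [m [hm _]].
  pose proof (image_mono hC hk' he hm) as hmono.
  exists (exist P Q (closed_subobject hmono (proj2_sig B)) : X), e.
  split; [exact (proj1 he) |].
  intros T; exact (proj2 he ⌊T⌋).
- intros A B D K f g p q hp hf.
  apply (regular_epi_full_subcategory hC).
  apply (hstab _ _ _ _ _ _ _ _
    (proj1 (pullback_full_subcategory hlim f g p q) hp)).
  now apply (regular_epi_full_subcategory hC).
Qed.

Definition point_inclusion (B : X) (p : Point B) : Point ⌊B⌋ :=
  Build_Point (C := C) (pt_ob := ⌊pt_ob p⌋) (pt_split p).

(** Pullbacks agree with those of [C], so the data is a change of base in [C] once its records are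
    repackaged. The inverse found there is a morphism of the subcategory by fullness. *)
Lemma full_subcategory_protomodular :
  finitely_complete C -> protomodular C -> protomodular X.
Proof.
intros hlim [_ hC]; split.
{ apply base_change_exists, full_subcategory_finitely_complete, hlim. }
intros B' B v U V U' V' tU tV f f' [hU sU] [hV sV] ht [g [hg1 hg2]].
pose (F := Build_PointHom (P := point_inclusion U) (Q := point_inclusion V)
  (pt_hom_proj f) (pt_hom_sec f)).
pose (F' := Build_PointHom (P := point_inclusion U') (Q := point_inclusion V')
  (pt_hom_proj f') (pt_hom_sec f')).
pose (G' := Build_PointHom (P := point_inclusion V') (Q := point_inclusion U')
  (pt_hom_proj g) (pt_hom_sec g)).
destruct (hC ⌊B'⌋ ⌊B⌋ v (point_inclusion U) (point_inclusion V)
  (point_inclusion U') (point_inclusion V') tU tV F F') as [G [hG1 hG2]].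
- exact (conj (proj1 (pullback_full_subcategory hlim _ _ _ _) hU) sU).
- exact (conj (proj1 (pullback_full_subcategory hlim _ _ _ _) hV) sV).
- exact ht.
- exists G'; split; apply PointHom_eq.
  + exact (f_equal (@pt_hom _ _ _ _) hg1).
  + exact (f_equal (@pt_hom _ _ _ _) hg2).
- exists (Build_PointHom (C := X) (P := V) (Q := U)
    (pt_hom_proj G) (pt_hom_sec G)).
  split; apply PointHom_eq.
  + exact (f_equal (@pt_hom _ _ _ _) hG1).
  + exact (f_equal (@pt_hom _ _ _ _) hG2).
Qed.

Lemma full_subcategory_pointed : pointed C -> pointed X.
Proof.
intros [Z [hi ht]].
assert (hZ : P Z).
{ (* The empty family out of a terminal object is jointly monic. *)
  apply (P_closed (I := Empty_set) (D := fun _ => Z) (p := fun _ => idm Z)).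
  - intros T x y _; destruct (ht T) as [u [_ hu]].
    now rewrite <- (hu x I), (hu y I).
  - intros []. }
exists (exist P Z hZ : X).
split; intros A; [exact (hi ⌊A⌋) | exact (ht ⌊A⌋)].
Qed.

Lemma full_subcategory_homological : homological C -> homological X.
Proof.
intros [h0 [hreg hproto]]; split; [exact (full_subcategory_pointed h0) |].
split; [exact (full_subcategory_regular hreg) |].
exact (full_subcategory_protomodular (proj1 hreg) hproto).
Qed.

End FullSubcategory.

(** * Application to the radical-free objects *)

Lemma radical_free_closed (C : Category) (hC : pointed C) (R : Radical C) :
  closed_under_jointly_monic (radical_free R).
Proof.
intros J L D p hp hD.
apply (zero_of_unique_maps hC); intros T x y.
apply (proj1 (rad_normal R L)), hp; intros i.
pose proof (naturality (rad_mu R) (p i)) as hnat; simpl in *.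
rewrite !comp_assoc, <- hnat, <- !comp_assoc; f_equal.
destruct (proj2 (hD i) T) as [u [_ hu]].
exact (eq_trans (eq_sym (hu _ I)) (hu _ I)).
Qed.

Theorem lemma4p1 (C : Category) (hC : homological C) (R : Radical C) :
  (forall (X Y : full_subcategory (radical_free R)) (f : Hom X Y),
     is_regular_epi f <->
     is_regular_epi (fmap (inclusion (radical_free R)) f)) /\
  homological (full_subcategory (radical_free R)).
Proof.
pose proof (radical_free_closed (proj1 hC) (R := R)) as hR.
split.
- intros X Y f; exact (regular_epi_full_subcategory hR (proj1 (proj2 hC)) f).
- exact (full_subcategory_homological hR hC).
Qed.
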